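(* Let $a_2,a_3$ be integers with $1<a_2<a_3$, $A=\{1,a_2,a_3\}$, and let $h$ be a positive integer with $X(h)\ge a_3$. Write $X(h)=(k+1)a_3+Y$ with integers $k$ and $0\le Y<a_3$, and let $p$ be the integer for which $SG(A,h-k,p)$ is a stride generator (the stride generator underlying the $h$-basis). Then this stride generator is canonical, i.e. all its breaks are canonical.
   Context: An integer $x$ has an $h$-representation if $x=c_3a_3+c_2a_2+c_1$ with integers $c_1,c_2,c_3\ge0$ and $c_1+c_2+c_3\le h$. $X(h)$ is one less than the smallest positive integer with no $h$-representation. For integers $n$ and $i\ge 0$, an integer $x$ has an $n$-generation of order $i$ if there are integers $c_1,c_2\ge 0$ with $x+ia_3=c_2a_2+c_1$ and $c_1+c_2\le n+i$. For integers $n$ and $p\ge0$, $SG(A,n,p)$ is a stride generator if: (A) every integer $0\le x<a_3$ has an $n$-generation of some order $\le p$; (B) at least one integer $0\le x<a_3$ has no $n$-generation of order $<p$; (C) at least one integer $0\le y<a_3$ has no $(n-1)$-generation of any order $\le p+1$. (Conditions (A),(B) determine $p$ uniquely from $n$.) Any $0\le y<a_3$ satisfying (C) is called a break. A break $y$ is canonical if there is no integer $j\ge 0$ with $y+ja_3=c_2a_2+c_1$, $c_1,c_2\ge 0$, $c_1+c_2\le (n-1)+j$. A stride generator is canonical if all its breaks are canonical. *)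

(* Defs.v *)
From mathcomp Require Import all_boot all_order all_algebra.
Set Implicit Arguments. Unset Strict Implicit. Unset Printing Implicit Defensive.
Import Order.TTheory GRing.Theory Num.Theory.

Definition hrep (a2 a3 h x : nat) : Prop :=
  exists c1 c2 c3 : nat, x = c3 * a3 + c2 * a2 + c1 /\ c1 + c2 + c3 <= h.

Definition is_X (a2 a3 h X : nat) : Prop :=
  ~ hrep a2 a3 h X.+1 /\ (forall y, 0 < y <= X -> hrep a2 a3 h y).

Definition ngen (a2 a3 : nat) (n : int) (i x : nat) : Prop :=
  exists c1 c2 : nat, x + i * a3 = c2 * a2 + c1 /\
    ((c1 + c2)%:Z <= n + i%:Z)%R.

Definition stride_generator (a2 a3 : nat) (n : int) (p : nat) : Prop :=
  [/\ (forall x, x < a3 -> exists2 i, i <= p & ngen a2 a3 n i x),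
      (exists2 x, x < a3 & forall i, i < p -> ~ ngen a2 a3 n i x) &
      (exists2 y, y < a3 & forall i, i <= p.+1 -> ~ ngen a2 a3 (n - 1)%R i y)].

Definition is_break (a2 a3 : nat) (n : int) (p y : nat) : Prop :=
  y < a3 /\ forall i, i <= p.+1 -> ~ ngen a2 a3 (n - 1)%R i y.

Definition canonical_break (a2 a3 : nat) (n : int) (y : nat) : Prop :=
  ~ exists j : nat, ngen a2 a3 (n - 1)%R j y.

Definition canonical_SG (a2 a3 : nat) (n : int) (p : nat) : Prop :=
  forall y, is_break a2 a3 n p y -> canonical_break a2 a3 n y.

(* Main.v *)
Require Import Defs.
From mathcomp Require Import all_boot all_order all_algebra.
From mathcomp Require Import zify.
Import Order.TTheory GRing.Theory Num.Theory.

(** Let [cost x i] be the least value of [c1 + c2 - i] over the representations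
    [x + i a3 = c2 a2 + c1], so that [x] has an [n]-generation of order [i] iff
    [cost x i <= n].  The differences of such representations form a lattice on
    which the cost is linear, so representations can be translated from one
    element to another.

    If [x] is a break then either [x + 1 = a3], or [x + 1] is represented with
    [c1 = 0] at cost at most [n].  Translating along these representations of
    [x + 1] and [y + 1], or along the representations of cost [n] of [x] and
    [y], shows that if one break [y] is noncanonical then so is every other.

    The element [Y + 1] is a break with no [(n-1)]-generation of order at most
    [k + 1].  If it were noncanonical, let [j > k + 1] be the first order at
    which its cost drops below [n].  Below [j] the costs are distinct and
    ordered as the residues of [Y + 1 + i a3] modulo [a2]; counting them gives
    [j + n <= a2 + a3 %/ a2 - 1], whereas representing
    [(a3 %/ a2) a2 - 1] forces [h = n + k >= a3 %/ a2 + a2 - 2]. *)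

Local Open Scope ring_scope.

Definition cost (a2 a3 x i : nat) : int :=
  ((x + i * a3) %/ a2 + (x + i * a3) %% a2)%N%:Z - i%:Z.

Lemma ngen_abs (a2 a3 x : nat) (n o c1 c2 : int) : 0 <= o ->
  x%:Z + o * a3%:Z = c2 * a2%:Z + c1 -> 0 <= c1 -> c1 < a2%:Z ->
  c1 + c2 <= n + o -> ngen a2 a3 n `|o|%N x.
Proof.
case: o => // i _ e c1_ge0 c1_lt le_n.
have c2_ge0 : 0 <= c2 by nia.
exists `|c1|%N, `|c2|%N; split; nia.
Qed.

(** Trading [a2] units for one [a2] never raises the cost, so Euclidean division is cheapest. *)
Lemma ngenP (a2 a3 : nat) (n : int) (i x : nat) :
  (0 < a2)%N -> ngen a2 a3 n i x <-> cost a2 a3 x i <= n.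
Proof.
rewrite /cost => a2_gt0; split=> [[c1 [c2 [e le_n]]]|le_n].
  rewrite e divnMDl // modnMDl.
  have := divn_eq c1 a2.
  set q := (c1 %/ a2)%N; set r := (c1 %% a2)%N; nia.
exists ((x + i * a3) %% a2)%N, ((x + i * a3) %/ a2)%N; split; last by lia.
exact: divn_eq.
Qed.

Lemma costE (a2 a3 x i : nat) :
  a2%:Z * cost a2 a3 x i = x%:Z + i%:Z * (a3%:Z - a2%:Z) +
    ((x + i * a3) %% a2)%N%:Z * (a2%:Z - 1).
Proof.
have := divn_eq (x + i * a3) a2; rewrite /cost.
set q := (_ %/ _)%N; set r := (_ %% _)%N; nia.
Qed.

(** * Breaks and the transfer of noncanonicity *)

Lemma ngen_break_eq (a2 a3 p : nat) (n : int) (x : nat) :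
  (0 < a2)%N ->
  (forall x, (x < a3)%N -> exists2 i, (i <= p)%N & ngen a2 a3 n i x) ->
  (x < a3)%N -> (forall i, (i <= p)%N -> ~ ngen a2 a3 (n - 1) i x) ->
  exists i r b : nat, [/\ (i <= p)%N, (r < a2)%N,
    (x + i * a3 = b * a2 + r)%N & r%:Z + b%:Z = n + i%:Z].
Proof.
move=> a2_gt0 A x_lt nb; have [i le_ip gi] := A x x_lt.
exists i, ((x + i * a3) %% a2)%N, ((x + i * a3) %/ a2)%N; split=> //.
- by rewrite ltn_mod.
- exact: divn_eq.
have /ngenP := nb i le_ip; move/ngenP: gi; rewrite /cost => /(_ a2_gt0) h1 h2.
by have := h2 a2_gt0; lia.
Qed.

(** Adding [a2] raises the cost at each order by exactly one, so a generation of [x + a2] would give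
    [x] cost at most [n - 1]. *)
Lemma break_ge (a2 a3 p : nat) (n : int) (x : nat) :
  (forall x, (x < a3)%N -> exists2 i, (i <= p)%N & ngen a2 a3 n i x) ->
  (0 < a2 < a3)%N -> (forall i, (i <= p)%N -> ~ ngen a2 a3 (n - 1) i x) ->
  (a3 <= x + a2)%N.
Proof.
move=> A a23 nb; rewrite leqNgt; apply/negP => /A[i le_ip /ngenP].
have /ngenP := nb i le_ip.
rewrite /cost (_ : x + a2 + i * a3 = 1 * a2 + (x + i * a3))%N; last by lia.
rewrite divnMDl ?modnMDl; lia.
Qed.

(* The value [s = -1], with [b = 0], encodes [x + 1 = a3]. *)
Lemma break_succ (a2 a3 p : nat) (n : int) (x : nat) : 1 <= n ->
  (forall x, (x < a3)%N -> exists2 i, (i <= p)%N & ngen a2 a3 n i x) ->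
  (x < a3)%N -> (forall i, (i <= p)%N -> ~ ngen a2 a3 (n - 1) i x) ->
  exists s b : int, [/\ -1 <= s, s <= p%:Z, 0 <= b,
    x%:Z + 1 + s * a3%:Z = b * a2%:Z & b - s <= n].
Proof.
move=> n_gt0 A x_lt nb; have [x1_lt|x1_ge] := ltnP x.+1 a3; last first.
  by exists (-1), 0; split; lia.
have [i le_ip [[|c1] [c2 [e le_n]]]] := A _ x1_lt.
  by exists i%:Z, c2%:Z; split; lia.
by case: (nb i le_ip); exists c1, c2; split; lia.
Qed.

Lemma break_transfer (a2 a3 p : nat) (n : int) (x y : nat) :
  (1 < a2 < a3)%N ->
  (forall x, (x < a3)%N -> exists2 i, (i <= p)%N & ngen a2 a3 n i x) ->
  (x < a3)%N -> (forall i, (i <= p)%N -> ~ ngen a2 a3 (n - 1) i x) ->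
  (y < a3)%N -> (forall i, (i <= p)%N -> ~ ngen a2 a3 (n - 1) i y) ->
  (exists j, ngen a2 a3 (n - 1) j y) -> exists j, ngen a2 a3 (n - 1) j x.
Proof.
move=> a23 A x_lt nbx y_lt nby [j gj].
have a2_gt0 : (0 < a2)%N by lia.
have lt_pj : (p < j)%N by rewrite ltnNge; apply/negP => /nby.
have x_ge : (a3 <= x + a2)%N by apply: break_ge nbx => //; lia.
have y_ge : (a3 <= y + a2)%N by apply: break_ge nby => //; lia.
have [i1 [r1 [b1 [le_i1 r1_lt e1 c1]]]] :=
  ngen_break_eq _ _ _ _ _ a2_gt0 A y_lt nby.
have [i2 [r2 [b2 [le_i2 r2_lt e2 c2]]]] :=
  ngen_break_eq _ _ _ _ _ a2_gt0 A x_lt nbx.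
have n_gt0 : 1 <= n by nia.
have [s1 [t1 [s1_ge s1_le t1_ge0 f1 d1]]] :=
  break_succ _ _ _ _ _ n_gt0 A y_lt nby.
have [s2 [t2 [s2_ge s2_le t2_ge0 f2 d2]]] :=
  break_succ _ _ _ _ _ n_gt0 A x_lt nbx.
have [r [b [r_lt e c]]] : exists r b : nat, [/\ (r < a2)%N,
    (y + j * a3 = b * a2 + r)%N & r%:Z + b%:Z <= n - 1 + j%:Z].
  exists ((y + j * a3) %% a2)%N, ((y + j * a3) %/ a2)%N; split.
  - by rewrite ltn_mod.
  - exact: divn_eq.
  by move/ngenP: gj; rewrite /cost => /(_ a2_gt0); lia.
have r_lt1 : (r < r1)%N.
  rewrite ltnNge; apply/negP => le_r.
  have : 0 <= (j%:Z - i1%:Z) * (a3%:Z - a2%:Z) by apply: mulr_ge0; lia.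
  have : 0 <= (r%:Z - r1%:Z) * (a2%:Z - 1) by apply: mulr_ge0; lia.
  have : 0 <= a2%:Z * (n - 1 + j%:Z - (r%:Z + b%:Z)) by apply: mulr_ge0; lia.
  have -> : n = r1%:Z + b1%:Z - i1%:Z by lia.
  lia.
have [le_r2|lt_r2] := leqP (r1 - r) r2.
  exists `|(i2%:Z + j%:Z - i1%:Z)%R|%N.
  apply: (ngen_abs _ _ _ _ _ (r2%:Z + r%:Z - r1%:Z)
    (b2%:Z + b%:Z - b1%:Z)); lia.
have [le_d|lt_d] := lerP (t2 - s2) (t1 - s1).
  exists `|(j%:Z + s2 - s1)%R|%N.
  apply: (ngen_abs _ _ _ _ _ r%:Z (b%:Z + t2 - t1)); lia.
(* The remaining case contradicts [nby]. As [x] and [y] differ by less than [a2], linearity of the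
   cost orders [i1, i2] and [s1, s2]. *)
have le_i12 : (i1 <= i2)%N.
  rewrite leqNgt; apply/negP => lt_i.
  have : 0 <= (i1%:Z - i2%:Z - 1) * (a3%:Z - a2%:Z) by apply: mulr_ge0; lia.
  have : 0 <= (r1%:Z - r2%:Z - 1) * (a2%:Z - 1) by apply: mulr_ge0; lia.
  have -> : r1%:Z = n + i1%:Z - b1%:Z by lia.
  have -> : r2%:Z = n + i2%:Z - b2%:Z by lia.
  lia.
have lt_s12 : s1 < s2.
  rewrite ltNge; apply/negP => le_s.
  have : 0 <= (s1 - s2) * (a3%:Z - a2%:Z) by apply: mulr_ge0; lia.
  have : 0 <= (t2 - t1 - 1 - s2 + s1) * a2%:Z by apply: mulr_ge0; lia.
  lia.
have [le_s|lt_s] := lerP (s2 - s1) i2%:Z.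
  case: (nby `|(i2%:Z - s2 + s1)%R|%N); first by lia.
  apply: (ngen_abs _ _ _ _ _ r2%:Z (b2%:Z - t2 + t1)); lia.
(* Adding the representation of [x + 1] to that of [y] and subtracting that of [x] represents
   [y + 1]; as [r2 < r1], one unit can be removed, leaving cost [t2 - s2 - 1]. *)
case: (nby `|(s2 - i2%:Z + i1%:Z)%R|%N); first by lia.
apply: (ngen_abs _ _ _ _ _ (r1%:Z - r2%:Z - 1) (b1%:Z + t2 - b2%:Z)); lia.
Qed.

(** * The first order at which the cost drops *)

Lemma cost_lt (a2 a3 y i j : nat) : (1 < a2 < a3)%N -> (i < j)%N ->
  ((y + i * a3) %% a2 <= (y + j * a3) %% a2)%N ->
  cost a2 a3 y i < cost a2 a3 y j.
Proof.
move=> a23 lt_ij le_r.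
have Ei := costE a2 a3 y i; have Ej := costE a2 a3 y j.
rewrite -(ltr_pM2l (_ : 0 < a2%:Z)) ?Ei ?Ej; last by lia.
have : 0 < (j%:Z - i%:Z) * (a3%:Z - a2%:Z) by apply: mulr_gt0; lia.
have : 0 <= (((y + j * a3) %% a2)%N%:Z - ((y + i * a3) %% a2)%N%:Z) *
            (a2%:Z - 1) by apply: mulr_ge0; lia.
lia.
Qed.

(** Equal shifts of order give residue drops congruent modulo [a2]; both lie in [[0, a2)], so they
    agree, and so do the changes of the quotient. *)
Lemma residue_shift (a2 a3 y i1 i2 l j : nat) : (i2 + l = i1 + j)%N ->
  ((y + i2 * a3) %% a2 <= (y + i1 * a3) %% a2)%N ->
  ((y + j * a3) %% a2 <= (y + l * a3) %% a2)%N -> (0 < a2)%N ->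
  cost a2 a3 y i1 - cost a2 a3 y i2 = cost a2 a3 y l - cost a2 a3 y j /\
  ((y + i1 * a3) %% a2 + (y + j * a3) %% a2 =
   (y + i2 * a3) %% a2 + (y + l * a3) %% a2)%N.
Proof.
move=> e le1 le2 a2_gt0; rewrite /cost.
have := divn_eq (y + i1 * a3) a2; have := divn_eq (y + i2 * a3) a2.
have := divn_eq (y + l * a3) a2; have := divn_eq (y + j * a3) a2.
have := ltn_pmod (y + i1 * a3) a2_gt0; have := ltn_pmod (y + l * a3) a2_gt0.
move: le1 le2.
set q1 := ((y + i1 * a3) %/ a2)%N; set r1 := ((y + i1 * a3) %% a2)%N.
set q2 := ((y + i2 * a3) %/ a2)%N; set r2 := ((y + i2 * a3) %% a2)%N.
set ql := ((y + l * a3) %/ a2)%N; set rl := ((y + l * a3) %% a2)%N.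
set qj := ((y + j * a3) %/ a2)%N; set rj := ((y + j * a3) %% a2)%N.
move=> le1 le2 lt1 lt2 ej el e2 e1.
have E : (q1%:Z + qj%:Z - q2%:Z - ql%:Z) * a2%:Z =
         (r2%:Z - r1%:Z) + (rl%:Z - rj%:Z).
  have : (i2 * a3 + l * a3 = i1 * a3 + j * a3)%N by rewrite -!mulnDl e.
  lia.
have : q1%:Z + qj%:Z - q2%:Z - ql%:Z = 0 by nia.
move=> E0; rewrite E0 mul0r in E; lia.
Qed.

Lemma leq_injective_bound (m N : nat) (f : nat -> nat) :
  (forall i, (i < m)%N -> (f i < N)%N) ->
  (forall i j, (i < j)%N -> (j < m)%N -> f i <> f j) -> (m <= N)%N.
Proof.
move=> f_lt f_inj.
have inj : injective (fun i : 'I_m => Ordinal (f_lt i (ltn_ord i))).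
  move=> i j [eq_f]; apply: val_inj => /=.
  have [lt|lt|//] := ltngtP i j.
    by case: (f_inj i j lt (ltn_ord j) eq_f).
  by case: (f_inj j i lt (ltn_ord i) (esym eq_f)).
by have := leq_card _ inj; rewrite !card_ord.
Qed.

Lemma first_drop_bound (a2 a3 y j : nat) (n : int) :
  (1 < a2 < a3)%N -> (y < a3)%N -> (0 < j)%N ->
  (forall i, (i < j)%N -> n <= cost a2 a3 y i) -> cost a2 a3 y j < n ->
  j%:Z + n <= a2%:Z + (a3 %/ a2)%N%:Z - 1.
Proof.
move=> a23 y_lt j_gt0 ge_n lt_n.
have a2_gt0 : (0 < a2)%N by lia.
pose r i := ((y + i * a3) %% a2)%N; pose F := cost a2 a3 y.
have {}ge_n i : (i < j)%N -> n <= F i := ge_n i.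
have {}lt_n : F j < n := lt_n.
have r_lt i : (r i < a2)%N by exact: ltn_pmod.
have r_gt i : (i < j)%N -> (r j < r i)%N.
  move=> lt_ij; rewrite ltnNge; apply/negP => le_r.
  have lt_F : F i < F j by exact: cost_lt.
  by have := ge_n i lt_ij; lia.
have r_ne i1 i2 : (i1 < i2)%N -> (i2 < j)%N -> r i1 <> r i2.
  move=> lt12 lt2 eq_r.
  (* The coincidence is copied to the pair of orders ending at [j], where [r_gt] forbids it. *)
  have e : (i2 + (j - (i2 - i1)) = i1 + j)%N by lia.
  have lt : (j - (i2 - i1) < j)%N by lia.
  have [] := residue_shift _ _ y _ _ _ _ e _ (ltnW (r_gt _ lt)) a2_gt0.
    by rewrite -/(r _) -eq_r.
  by have := r_gt _ lt; rewrite /r in eq_r *; lia.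
have r_cost i1 i2 : (i1 < j)%N -> (i2 < j)%N -> (r i1 < r i2)%N -> F i1 < F i2.
  move=> lt1 lt2 lt_r.
  have [lt12|le21] := ltnP i1 i2; first by apply: cost_lt => //; exact: ltnW.
  have lt21 : (i2 < i1)%N.
    rewrite ltn_neqAle le21 andbT.
    by apply: contraTneq lt_r => ->; rewrite ltnn.
  have e : (i1 + (j - (i1 - i2)) = i2 + j)%N by lia.
  have lt : (j - (i1 - i2) < j)%N by lia.
  (* Copied to end at [j], the same shift takes the cost from at least [n] to below [n]. *)
  have [eq_F _] :
      F i2 - F i1 = F (j - (i1 - i2))%N - F j /\ _ :=
    residue_shift _ _ y _ _ _ _ e (ltnW lt_r) (ltnW (r_gt _ lt)) a2_gt0.
  by have := ge_n _ lt; lia.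
have F_le i : (i < j)%N -> (r i <= r 0)%N -> F i <= F 0%N.
  move=> lt_ij le_r; have [->//|i_gt0] := posnP i.
  apply/ltW/r_cost => //; rewrite ltn_neqAle le_r andbT.
  by apply/eqP => eq_r; apply: (r_ne 0%N i).
(* The costs of the orders with residue at most [r 0] are distinct values in
   [[n, F 0]], and there are fewer than [a2 - r 0] larger residues. *)
pose f i := if (r i <= r 0)%N then `|(F i - n)%R|%N
            else (`|(F 0%N - n)%R| + (r i - r 0))%N.
have f_inj i1 i2 : (i1 < i2)%N -> (i2 < j)%N -> f i1 <> f i2.
  move=> lt12 lt2; have lt1 := ltn_trans lt12 lt2.
  have := ge_n _ lt1; have := ge_n _ lt2; have := ge_n _ j_gt0.
  have := r_ne _ _ lt12 lt2.
  have := r_cost _ _ lt1 lt2; have := r_cost _ _ lt2 lt1.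
  have := F_le _ lt1; have := F_le _ lt2.
  rewrite /f; move: (F i1) (F i2) (F 0%N) => F1 F2 F0.
  move: (r i1) (r i2) (r 0%N) => s1 s2 s0.
  case: ifP; case: ifP; lia.
pose N := (`|(F 0%N - n)%R| + (a2 - r 0%N))%N.
have f_lt i : (i < j)%N -> (f i < N)%N.
  move=> lt_i; have := ge_n _ lt_i; have := ge_n _ j_gt0; have := F_le _ lt_i.
  have := r_lt i; have := r_lt 0%N; rewrite /f /N.
  move: (F i) (F 0%N) (r i) (r 0%N) => F1 F0 s1 s0.
  case: ifP; lia.
have F0E : F 0%N = (y %/ a2)%N%:Z + (r 0%N)%:Z
  by rewrite /F /cost /r mul0n addn0; lia.
have n_le := ge_n _ j_gt0.
have r0_lt := r_lt 0%N.
(* Here [N = y %/ a2 + a2 - n], which is one too large only if [y %/ a2 = a3 %/ a2]. *)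
have [lt_q|le_q] := ltnP (y %/ a2) (a3 %/ a2).
  have := leq_injective_bound _ _ f f_lt f_inj; rewrite /N; lia.
have Ey := divn_eq y a2; have Ea := divn_eq a3 a2.
have eq_q : (y %/ a2 = a3 %/ a2)%N
  by apply/eqP; rewrite eqn_leq le_q leq_div2r // ltnW.
have r0E : r 0%N = (y %% a2)%N by rewrite /r mul0n addn0.
have s_lt := ltn_pmod a3 a2_gt0.
have lt_r0s : (r 0%N < a3 %% a2)%N by rewrite r0E; lia.
(* The residue [r 0 + a2 - a3 %% a2] of the virtual order -1 exceeds [r 0] and
   is missed by every order below [j], since the next residue would be [r 0];
   this improves the count by one. *)
pose g i := if (i < j)%N then f i else (`|(F 0%N - n)%R| + (a2 - a3 %% a2))%N.
have g_lt i : (i < j.+1)%N -> (g i < N)%N.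
  by rewrite /g; case: ifP => [/f_lt//|] _ _; rewrite /N; lia.
have g_inj i1 i2 : (i1 < i2)%N -> (i2 < j.+1)%N -> g i1 <> g i2.
  move=> lt12 lt2; have lt1 : (i1 < j)%N by lia.
  rewrite /g lt1; case: ifP => [lt2j|_]; first exact: f_inj.
  rewrite /f; case: ifP => [le_r|/negbT gt_r eq_f].
    by have := F_le _ lt1 le_r; have := ge_n _ lt1; lia.
  have rE : (r i1 + a3 %% a2 = r 0%N + a2)%N by lia.
  have : r i1.+1 = r 0%N.
    have -> : r i1.+1 = ((r i1 + a3 %% a2) %% a2)%N.
      rewrite /r modnDm mulSn; congr (_ %% _)%N; lia.
    by rewrite rE modnDr modn_small.
  have [lt_ij|le_ji] := ltnP i1.+1 j; first exact/nesym/r_ne.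
  have -> : i1.+1 = j by lia.
  by have := r_gt _ j_gt0; lia.
have := leq_injective_bound _ _ g g_lt g_inj; rewrite /N; lia.
Qed.

(** * From [h]-representations to generations *)

Lemma hrep_ngen (a2 a3 h l x : nat) : (x < a3)%N ->
  hrep a2 a3 h (l * a3 + x) <->
  exists2 i, (i <= l)%N & ngen a2 a3 (h%:Z - l%:Z) i x.
Proof.
move=> x_lt; split=> [[c1 [c2 [c3 [e le_h]]]]|[i le_il [c1 [c2 [e le_h]]]]].
  have le_c3 : (c3 <= l)%N by nia.
  exists (l - c3)%N; first exact: leq_subr.
  exists c1, c2; split; last by lia.
  by rewrite mulnBl; have := leq_mul le_c3 (leqnn a3); lia.
exists c1, c2, (l - i)%N; split; last by lia.
by rewrite mulnBl; have := leq_mul le_il (leqnn a3); lia.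
Qed.

Lemma is_X_lower (a2 a3 h X : nat) : (1 < a2 < a3)%N -> is_X a2 a3 h X ->
  (a3 <= X)%N -> (a3 %/ a2 + a2 <= h + 2)%N.
Proof.
move=> a23 [_ X_rep] le_X; have a2_gt0 : (0 < a2)%N by lia.
have q_gt0 : (0 < a3 %/ a2)%N by rewrite divn_gt0; lia.
have := leq_divM a3 a2; set q := (a3 %/ a2)%N in q_gt0 * => le_q.
have [|c1 [c2 [c3 [e le_h]]]] := X_rep (q * a2 - 1)%N.
  by have := leq_pmull a2 q_gt0; lia.
case: c3 e le_h => [|c3]; last by rewrite mulSn; lia.
rewrite mul0n addn0 add0n => e le_h.
have lt_q : (c2 < q)%N.
  by rewrite ltnNge; apply/negP => le_c; have := leq_mul le_c (leqnn a2); lia.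
(* Each of the [t] further copies of [a2] left out costs [a2] units instead, so [t = 0] is cheapest,
   with [q - 1 + a2 - 1] terms. *)
have [t q_eq] : exists t, q = (c2 + 1 + t)%N by exists (q - c2.+1)%N; lia.
have := leq_pmulr t a2_gt0; rewrite q_eq in e *; lia.
Qed.

Local Close Scope ring_scope.

Theorem theorem2 (a2 a3 h X k Y p : nat) :
  1 < a2 -> a2 < a3 -> 0 < h ->
  is_X a2 a3 h X -> a3 <= X ->
  X = k.+1 * a3 + Y -> Y < a3 ->
  stride_generator a2 a3 (h%:Z - k%:Z)%R p ->
  canonical_SG a2 a3 (h%:Z - k%:Z)%R p.
Proof.
move=> a2_gt1 a2_lt _ isX le_X eX Y_lt [A [xB xB_lt nB] _] y [y_lt nby] gy.
have a23 : 1 < a2 < a3 by rewrite a2_gt1.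
have a2_gt0 : 0 < a2 by lia.
have le_q := is_X_lower a2 a3 h X a23 isX le_X.
case: isX => nX X_rep.
have rep l x : l <= k.+1 -> 0 < x -> x < a3 -> l * a3 + x <= X ->
    exists2 i, i <= l & ngen a2 a3 (h%:Z - l%:Z)%R i x.
  move=> le_l x_gt0 x_lt le_x; apply/hrep_ngen => //; apply: X_rep; lia.
have n_ge0 : (0 <= h%:Z - k%:Z)%R.
  have [i _ [c1 [c2 [e le_c]]]] := A _ xB_lt.
  rewrite leNgt; apply/negP => n_lt0.
  have lt_ci : c1 + c2 < i by lia.
  have := leq_mul lt_ci (ltnW a2_lt); have := leq_pmulr c1 a2_gt0; lia.
(* All [k * a3 + x] with [0 < x < a3] lie below [X], so [k < p] would contradict (B) at [xB]. *)
have le_pk : p <= k.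
  have [->//|p_gt0] := posnP p.
  have xB_gt0 : 0 < xB.
    rewrite lt0n; apply/eqP => xB0; apply: (nB 0) => //.
    by exists 0, 0; split; lia.
  have [|i le_ik gi] := rep k xB (leqnSn k) xB_gt0 xB_lt.
    by rewrite eX mulSn; lia.
  by rewrite leqNgt; apply/negP => lt_kp; apply: (nB i) => //; lia.
have Y1_lt : Y.+1 < a3.
  rewrite ltn_neqAle Y_lt andbT; apply/eqP => eY.
  (* Now [X + 1 = (k + 2) a3], which forces [h <= k + 1]; then 1 would need a generation of cost at
     most 0. *)
  have le_hk : h <= k.+1.
    rewrite leqNgt; apply/negP => lt_h; apply: nX.
    by exists 0, 0, k.+2; split; lia.
  have [||i le_i [c1 [c2 [e le_c]]]] := rep k.+1 1 (leqnn _) isT; [by lia..|].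
  have le_ci : c1 + c2 <= i by lia.
  have := leq_mul le_ci (ltnW a2_lt); have := leq_pmulr c1 a2_gt0; lia.
have nY i : i <= k.+1 -> ~ ngen a2 a3 (h%:Z - k%:Z - 1)%R i Y.+1.
  move=> le_i gi; apply: nX; rewrite eX -addnS; apply/hrep_ngen => //.
  by exists i => //; move: gi; congr ngen; lia.
have [j0 gj0] : exists j, ngen a2 a3 (h%:Z - k%:Z - 1)%R j Y.+1.
  apply: (break_transfer a2 a3 p _ _ y) => //.
  - by move=> i le_i; apply: nY; lia.
  - by move=> i le_i; apply: nby; lia.
have ex_j : exists j, (cost a2 a3 Y.+1 j <= h%:Z - k%:Z - 1)%R.
  by exists j0; apply/ngenP.
have [j gj j_min] := ex_minnP ex_j.
have lt_kj : k.+1 < j.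
  by rewrite ltnNge; apply/negP => /nY; apply; apply/ngenP.
(* With [j >= k + 2] this gives [h <= a2 + a3 %/ a2 - 3], against [le_q]. *)
suff : (j%:Z + (h%:Z - k%:Z) <= a2%:Z + (a3 %/ a2)%N%:Z - 1)%R by lia.
apply: (first_drop_bound a2 a3 Y.+1) => //; [by lia| |by lia].
move=> i lt_ij; rewrite leNgt; apply/negP => lt_cost.
by have := j_min i; lia.
Qed.
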